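(* Let $\mathcal A$ be a deterministic, uniquely represented streaming algorithm maintaining a signed multiset over a set $S$ of $n$ items, using fewer than $n$ bits of storage (so it has at most $2^k$ states for some $k<n$), with associated map $u$ from signed multisets to states. Then there is a nonempty unit multiset $D$ over $S$ with $u(D)=u(\emptyset)$, i.e. the algorithm cannot distinguish $D$ from the empty multiset.
   Context: A signed multiset over a finite set $S$ is a map $f:S\to\mathbb Z$; it is empty if $f\equiv 0$, and it is a unit multiset if $f(x)\in\{-1,0,1\}$ for all $x$. Inserting $x$ increases $f(x)$ by one; deleting $x$ decreases $f(x)$ by one; signed multisets form a commutative group $M$ under pointwise addition. A deterministic streaming algorithm maintaining a signed multiset has a fixed initial state and processes insert/delete operations one at a time, each operation deterministically transforming the current state. It is uniquely represented if there is a map $u$ from $M$ to states such that after any sequence of updates producing multiset $A$ (regardless of order) the state is $u(A)$. *)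

(* Defs.v *)
From HB Require Import structures.
From mathcomp Require Import all_boot all_order all_algebra.

Set Implicit Arguments.
Unset Strict Implicit.
Unset Printing Implicit Defensive.

Import GRing.Theory.
Local Open Scope ring_scope.

(* The group structure is the pointwise one that [{ffun S -> int}] inherits
   from [int]; in particular the empty multiset is [0]. *)
Notation signed_multiset S := {ffun S -> int}.

Definition unit_multiset (S : finType) (f : signed_multiset S) : Prop :=
  forall x : S, f x \in [:: -1; 0; 1].

Inductive update (S : finType) : Type :=
  | Insert of S
  | Delete of S.

Definition apply_update (S : finType) (f : signed_multiset S) (o : update S) :
    signed_multiset S :=
  match o with
  | Insert x => [ffun y => if y == x then f y + 1 else f y]
  | Delete x => [ffun y => if y == x then f y - 1 else f y]
  end.

Definition multiset_of (S : finType) (ops : seq (update S)) :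
    signed_multiset S :=
  foldl (@apply_update S) 0 ops.

Record streaming_algorithm (S : finType) : Type := StreamingAlgorithm {
  state : finType;
  init : state;
  step : state -> update S -> state
}.

Definition run (S : finType) (A : streaming_algorithm S)
    (ops : seq (update S)) : state A :=
  foldl (@step S A) (init A) ops.

(* Every signed multiset is [multiset_of ops] for some [ops], so at most one
   [u] satisfies this for a given algorithm. *)
Definition uniquely_represented_by (S : finType) (A : streaming_algorithm S)
    (u : signed_multiset S -> state A) : Prop :=
  forall ops : seq (update S), run A ops = u (multiset_of ops).

(* Main.v *)
(** Among the [2 ^ n] subsets of [S], two distinct ones [X] and [Y] have
    indicator multisets that reach the same state.  Deleting the items of [Y]
    from either of them leads to a common state, which represents both the
    nonempty unit multiset [1_X - 1_Y] and the empty multiset [1_Y - 1_Y]. *)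

Require Import Defs.
From mathcomp Require Import all_boot all_order all_algebra.

Set Implicit Arguments.
Unset Strict Implicit.
Unset Printing Implicit Defensive.

Import GRing.Theory.

(** Stated for sequences because a run consumes a list of updates; on the duplicate-free [enum X] it
    becomes the indicator of [X]. *)
Definition multiplicity (S : finType) (s : seq S) : signed_multiset S :=
  [ffun x => (count_mem x s)%:R%R].

Lemma foldl_insert (S : finType) (f : signed_multiset S) (s : seq S) :
  foldl (@apply_update S) f [seq Insert x | x <- s] = (f + multiplicity s)%R.
Proof.
elim: s f => [|x s IHs] f /=; apply/ffunP => y.
  by rewrite !ffunE addr0.
rewrite IHs !ffunE /= eq_sym natrD addrA.
by case: eqP; rewrite ?addr0.
Qed.

Lemma foldl_delete (S : finType) (f : signed_multiset S) (s : seq S) :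
  foldl (@apply_update S) f [seq Delete x | x <- s] = (f - multiplicity s)%R.
Proof.
elim: s f => [|x s IHs] f /=; apply/ffunP => y.
  by rewrite !ffunE subr0.
rewrite IHs !ffunE /= eq_sym natrD opprD addrA.
by case: eqP; rewrite ?subr0.
Qed.

Lemma multiplicity_enum (S : finType) (X : {set S}) (x : S) :
  multiplicity (enum X) x = (x \in X)%:R%R.
Proof. by rewrite ffunE count_uniq_mem ?enum_uniq// mem_enum. Qed.

(** The current state determines all later ones, so deleting the items of [r] from equal states
    leads to equal states. *)
Lemma uniquely_represented_sub (S : finType) (A : streaming_algorithm S)
    (u : signed_multiset S -> state A) (s t r : seq S) :
  uniquely_represented_by u -> u (multiplicity s) = u (multiplicity t) ->
  u (multiplicity s - multiplicity r)%R = u (multiplicity t - multiplicity r)%R.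
Proof.
move=> uA eq_u.
pose inserts v : seq (update S) := [seq Insert x | x <- v].
have run_inserts v : run A (inserts v) = u (multiplicity v).
  by rewrite uA /multiset_of foldl_insert add0r.
have run_sub v : u (multiplicity v - multiplicity r)%R =
    foldl (@step S A) (u (multiplicity v)) [seq Delete x | x <- r].
  (* Inserting [v] and then deleting [r] is refolded into a single run from [init A], the only kind
     of run that [uA] speaks about. *)
  rewrite -run_inserts /run -foldl_cat -/(run _ _) uA.
  by rewrite /multiset_of foldl_cat foldl_insert foldl_delete add0r.
by rewrite !run_sub eq_u.
Qed.

Theorem theorem2 (S : finType) (n : nat) (cardS : #|S| = n)
    (A : streaming_algorithm S) (k : nat) (ltkn : (k < n)%N)
    (storage : (#|state A| <= 2 ^ k)%N)
    (u : signed_multiset S -> state A) (uA : uniquely_represented_by u) :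
  exists D : signed_multiset S,
    [/\ D <> 0%R, unit_multiset D & u D = u 0%R].
Proof.
pose g (X : {set S}) := u (multiplicity (enum X)).
have /injectivePn[X [Y neqXY eqg]] : ~~ injectiveb g.
  (* Pigeonhole: an injective [g] would give [2 ^ n <= #|state A| <= 2 ^ k], against [k < n]. *)
  apply/injectiveP => /leq_card; apply/negP; rewrite -ltnNge.
  apply: leq_ltn_trans storage _.
  by rewrite -cardsT -powersetT card_powerset cardsT cardS ltn_exp2l.
exists (multiplicity (enum X) - multiplicity (enum Y))%R; split.
- move=> /eqP; rewrite subr_eq0 => /eqP eqXY; case/eqP: neqXY.
  apply/setP => x; have := congr1 (fun f : signed_multiset S => f x) eqXY.
  by rewrite !multiplicity_enum; do 2 case: (x \in _).
(* The second [ffunE] is confined to the subtracted term, so that [multiplicity] stays folded for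
   [multiplicity_enum]. *)
- move=> x; rewrite ffunE [X in (_ + X)%R]ffunE !multiplicity_enum.
  by do 2 case: (x \in _).
- by rewrite (uniquely_represented_sub _ uA eqg) subrr.
Qed.
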